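(* Let $0 < m < n$ be integers and let $\mathrm{Gr}_{m,n}=\{e_P=2P-\mathbf{1}: P \text{ an orthogonal projection of rank } m \text{ on } \mathbb{C}^n\}\subseteq U_n$. Let $H \subseteq U_n$ be a subgroup acting on $\mathrm{Gr}_{m,n}$ by $h\cdot e_P = he_Ph^{-1}$. If there is an orthogonal projection $P$ of rank $m$ such that $$\mathrm{radius}_\infty(\{he_P h^{-1} : h \in H\}) < \pi/2,$$ then there is an orthogonal projection $Q$ of rank $m$ such that $hQ = Qh$ for all $h \in H$. The bound $\pi/2$ is optimal: for $m=1$, $n=2$, there exist a subgroup $H\subseteq U_2$ and a rank-one projection $P$ with $\mathrm{radius}_\infty(\{he_Ph^{-1}: h\in H\})=\pi/2$ such that no rank-one projection commutes with all elements of $H$.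
   Context: $U_n$ is the unitary group, $\|\cdot\|_\infty$ the operator norm; $d_\infty(u,v)$ is the infimum of $\int\|\dot\alpha(t)\|_\infty\,dt$ over piecewise smooth curves in $U_n$ joining $u$ and $v$. For $A\subseteq\mathrm{Gr}_{m,n}$, $\mathrm{radius}_\infty(A)=\inf\{r:\exists c\in\mathrm{Gr}_{m,n},\ d_\infty(c,a)\le r\ \forall a\in A\}$. *)

(* Defs.v *)
From HB Require Import structures.
From mathcomp Require Import all_boot all_order all_algebra.
From mathcomp Require Import all_classical all_reals all_analysis.
From mathcomp Require Import complex.
Set Implicit Arguments. Unset Strict Implicit. Unset Printing Implicit Defensive.
Import Order.TTheory GRing.Theory Num.Theory.
Import numFieldNormedType.Exports.
Local Open Scope classical_set_scope.
Local Open Scope ring_scope.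

Section Unitary.
Variable R : realType.
Local Notation C := (R[i]).

Definition adj (p q : nat) (A : 'M[C]_(p, q)) : 'M[C]_(q, p) :=
  (map_mx (@conjc R) A)^T.

Definition unitary (n : nat) : set 'M[C]_n :=
  [set U | U *m adj U = 1%:M /\ adj U *m U = 1%:M].
Arguments unitary : clear implicits.

Definition orth_proj (n : nat) (P : 'M[C]_n) : Prop :=
  P *m P = P /\ adj P = P.

Definition eP (n : nat) (P : 'M[C]_n) : 'M[C]_n := (2%:R : C) *: P - 1%:M.

Definition Grass (m n : nat) : set 'M[C]_n :=
  [set e | exists P : 'M[C]_n, orth_proj P /\ \rank P = m /\ e = eP P].
Arguments Grass : clear implicits.

Definition vnorm (n : nat) (v : 'cV[C]_n) : R :=
  Num.sqrt (\sum_(i < n) (complex.Re (v i ord0) ^+ 2 + complex.Im (v i ord0) ^+ 2)).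

Definition opnorm (n : nat) (A : 'M[C]_n) : R :=
  sup [set vnorm (A *m v) | v in [set v : 'cV[C]_n | vnorm v = 1]].

Definition re_coord (n : nat) (alpha : R -> 'M[C]_n) (i j : 'I_n) : R -> R :=
  fun t => complex.Re (alpha t i j).
Definition im_coord (n : nat) (alpha : R -> 'M[C]_n) (i j : 'I_n) : R -> R :=
  fun t => complex.Im (alpha t i j).

Definition C1_on (f : R -> R) (a b : R) : Prop :=
  exists g : R -> R, {within `[a, b], continuous g} /\
    forall t, t \in `]a, b[ -> is_derive t 1 f (g t).

Definition pw_C1_wrt (k : nat) (s : nat -> R) (f : R -> R) : Prop :=
  {within `[0, 1], continuous f} /\
  forall l, (l < k)%N -> C1_on f (s l) (s l.+1).

Definition pw_smooth_curve (n : nat) (alpha : R -> 'M[C]_n)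
    (u v : 'M[C]_n) : Prop :=
  alpha 0 = u /\ alpha 1 = v /\
  (forall t, t \in `[0, 1] -> unitary n (alpha t)) /\
  exists (k : nat) (s : nat -> R),
    s 0%N = 0 /\ s k = 1 /\ (forall l, (l < k)%N -> s l < s l.+1) /\
    forall i j, pw_C1_wrt k s (re_coord alpha i j) /\
                pw_C1_wrt k s (im_coord alpha i j).

Definition dcurve (n : nat) (alpha : R -> 'M[C]_n) (t : R) : 'M[C]_n :=
  \matrix_(i, j) ((derive (re_coord alpha i j) t 1) +i* (derive (im_coord alpha i j) t 1))%C.

Definition curve_length (n : nat) (alpha : R -> 'M[C]_n) : \bar R :=
  (\int[@lebesgue_measure R]_(t in `[(0:R)%R, (1:R)%R]) (opnorm (dcurve alpha t))%:E)%E.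

Definition dinf (n : nat) (u v : 'M[C]_n) : \bar R :=
  ereal_inf [set L | exists alpha : R -> 'M[C]_n,
                       pw_smooth_curve alpha u v /\ L = curve_length alpha].

Definition radius_inf (m n : nat) (A : set 'M[C]_n) : \bar R :=
  ereal_inf [set r%:E | r in [set r : R | exists c, Grass m n c /\
                                     forall a, A a -> (dinf c a <= r%:E)%E]].

Definition subgroupU (n : nat) (H : set 'M[C]_n) : Prop :=
  H `<=` unitary n /\ H 1%:M /\
  (forall g h, H g -> H h -> H (g *m h)) /\
  (forall h, H h -> H (invmx h)).

Definition conj_orbit (n : nat) (H : set 'M[C]_n) (e : 'M[C]_n) : set 'M[C]_n :=
  [set h *m e *m invmx h | h in H].

End Unitary.
Arguments Grass {R} m n.
Arguments unitary {R} n.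
Arguments radius_inf {R} m {n} A.

(* Main.v *)
(* A curve of unitaries of length [L] moves each unit vector [v] by an angle at
   most [L], because [acos (Re <x 0, x t>)] grows no faster than the speed of the
   spherical curve [x t = alpha t v].  Hence a radius below [pi / 2] provides a centre
   [c] and [kappa > 0] with [Re <c v, a v> >= kappa |v|^2] for all [v] and all [a] in
   the orbit.  This condition on [a] is closed, convex and, once imposed on all
   [H]-conjugates, [H]-invariant; so the element [A] of least Frobenius norm
   satisfying it commutes with [H].  The same inequality forces the Hermitian
   matrices [A] and [c] to have equal signature, hence the spectral projection of [A]
   on its nonnegative eigenvalues has rank [m].
   For optimality, [H] is the group of unitaries commuting or anticommuting with the
   Pauli matrix [Z]: the orbit of [Z] is [{Z, -Z}], both points are a quarter turn
   away from the Pauli matrix [X], and only scalars commute with [H]. *)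
Require Import Defs.
From HB Require Import structures.
From mathcomp Require Import all_boot all_order all_algebra.
From mathcomp Require Import all_classical all_reals all_analysis.
From mathcomp Require Import measurable_realfun complex ring lra.
Import Order.TTheory GRing.Theory Num.Theory.
Import numFieldNormedType.Exports.
Set Implicit Arguments. Unset Strict Implicit. Unset Printing Implicit Defensive.
Local Open Scope classical_set_scope.
Local Open Scope ring_scope.

(** * The real Frobenius inner product, unitaries and reflections *)

Section FrobeniusProduct.
Variable R : realType.
Local Notation C := (R[i]).

(** The real part of the Hilbert-Schmidt product: complex matrices become a real Euclidean space,
    where convexity and angles make sense. The coordinate form lets limits and derivatives be taken
    entrywise. *)
Definition frob (p q : nat) (A B : 'M[C]_(p, q)) : R :=
  \sum_i \sum_j (complex.Re (A i j) * complex.Re (B i j)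
                 + complex.Im (A i j) * complex.Im (B i j)).

Lemma ReD (x y : C) : complex.Re (x + y) = complex.Re x + complex.Re y.
Proof. by case: x; case: y. Qed.

Lemma ImD (x y : C) : complex.Im (x + y) = complex.Im x + complex.Im y.
Proof. by case: x; case: y. Qed.

Lemma Re_sum (I : Type) (r : seq I) (P : pred I) (F : I -> C) :
  complex.Re (\sum_(i <- r | P i) F i) = \sum_(i <- r | P i) complex.Re (F i).
Proof. exact: (big_morph _ ReD). Qed.

Lemma adjE (p q : nat) (A : 'M[C]_(p, q)) i j : adj A i j = conjc (A j i).
Proof. by rewrite !mxE. Qed.

Lemma adjK (p q : nat) (A : 'M[C]_(p, q)) : adj (adj A) = A.
Proof. by apply/matrixP => i j; rewrite !adjE conjcK. Qed.

Lemma adjM (p q r : nat) (A : 'M[C]_(p, q)) (B : 'M[C]_(q, r)) :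
  adj (A *m B) = adj B *m adj A.
Proof. by rewrite /adj map_mxM trmx_mul. Qed.

Lemma adjD (p q : nat) (A B : 'M[C]_(p, q)) : adj (A + B) = adj A + adj B.
Proof. by rewrite /adj map_mxD linearD. Qed.

Lemma adjN (p q : nat) (A : 'M[C]_(p, q)) : adj (- A) = - adj A.
Proof. by rewrite /adj map_mxN linearN. Qed.

Lemma adj1 (n : nat) : adj (1%:M : 'M[C]_n) = 1%:M.
Proof. by rewrite /adj map_mx1 trmx1. Qed.

Lemma adj_realZ (p q : nat) (a : R) (A : 'M[C]_(p, q)) :
  adj (a%:C%C *: A) = a%:C%C *: adj A.
Proof. by rewrite /adj map_mxZ linearZ /= oppr0. Qed.

Lemma frobE (p q : nat) (A B : 'M[C]_(p, q)) :
  frob A B = complex.Re (\tr (adj A *m B)).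
Proof.
rewrite /frob /mxtrace exchange_big Re_sum; apply: eq_bigr => j _.
rewrite !mxE Re_sum; apply: eq_bigr => i _.
by rewrite adjE; case: (A i j) (B i j) => [a b] [c d] /=; rewrite mulNr opprK.
Qed.

Lemma frobC (p q : nat) (A B : 'M[C]_(p, q)) : frob A B = frob B A.
Proof.
by apply: eq_bigr => i _; apply: eq_bigr => j _; congr (_ + _); rewrite mulrC.
Qed.

Lemma frobDr (p q : nat) (A B D : 'M[C]_(p, q)) :
  frob A (B + D) = frob A B + frob A D.
Proof. by rewrite !frobE mulmxDr linearD ReD. Qed.

Lemma frobDl (p q : nat) (A B D : 'M[C]_(p, q)) :
  frob (A + B) D = frob A D + frob B D.
Proof. by rewrite frobC frobDr !(frobC D). Qed.

Lemma frobZr (p q : nat) (a : R) (A B : 'M[C]_(p, q)) :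
  frob A (a%:C%C *: B) = a * frob A B.
Proof.
rewrite !frobE -scalemxAr linearZ /=.
by case: (\tr _) => x y /=; rewrite mul0r subr0.
Qed.

Lemma frobZl (p q : nat) (a : R) (A B : 'M[C]_(p, q)) :
  frob (a%:C%C *: A) B = a * frob A B.
Proof. by rewrite frobC frobZr frobC. Qed.

Lemma frobNr (p q : nat) (A B : 'M[C]_(p, q)) : frob A (- B) = - frob A B.
Proof. by rewrite -mulN1r -frobZr rmorphN1 scaleN1r. Qed.

Lemma frobNl (p q : nat) (A B : 'M[C]_(p, q)) : frob (- A) B = - frob A B.
Proof. by rewrite frobC frobNr frobC. Qed.

Lemma frob0r (p q : nat) (A : 'M[C]_(p, q)) : frob A 0 = 0.
Proof. by rewrite frobE mulmx0 linear0. Qed.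

Lemma frob_ge0 (p q : nat) (A : 'M[C]_(p, q)) : 0 <= frob A A.
Proof.
by apply: sumr_ge0 => i _; apply: sumr_ge0 => j _; rewrite -!expr2 addr_ge0 ?sqr_ge0.
Qed.

Lemma frob_eq0 (p q : nat) (A : 'M[C]_(p, q)) : frob A A <= 0 -> A = 0.
Proof.
move=> A0; apply/matrixP => i j; rewrite !mxE.
have h k l : 0 <= complex.Re (A k l) * complex.Re (A k l)
                 + complex.Im (A k l) * complex.Im (A k l).
  by rewrite -!expr2 addr_ge0 ?sqr_ge0.
have /eqP : frob A A = 0 by apply/eqP; rewrite eq_le A0 frob_ge0.
rewrite /frob psumr_eq0; last by move=> k _; apply: sumr_ge0 => l _; exact: h.
move=> /allP/(_ i (mem_index_enum _))/=; rewrite psumr_eq0; last by move=> l _; exact: h.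
move=> /allP/(_ j (mem_index_enum _))/=.
rewrite -!expr2 paddr_eq0 ?sqr_ge0// !sqrf_eq0.
by case: (A i j) => a b /= /andP[/eqP -> /eqP ->].
Qed.

Lemma frob_mull (p q r : nat) (M : 'M[C]_(p, q)) (A : 'M[C]_(q, r)) (B : 'M[C]_(p, r)) :
  frob (M *m A) B = frob A (adj M *m B).
Proof. by rewrite !frobE adjM mulmxA. Qed.

Lemma frob_mulr (p q r : nat) (M : 'M[C]_(q, r)) (A : 'M[C]_(p, q)) (B : 'M[C]_(p, r)) :
  frob (A *m M) B = frob A (B *m adj M).
Proof. by rewrite !frobE adjM -mulmxA mxtrace_mulC mulmxA. Qed.

Lemma frob_adj (p q : nat) (A B : 'M[C]_(p, q)) : frob (adj A) (adj B) = frob A B.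
Proof.
rewrite /frob exchange_big; apply: eq_bigr => i _; apply: eq_bigr => j _.
by rewrite !adjE; case: (A i j) (B i j) => [a b] [c d] /=; rewrite mulrNN.
Qed.

Lemma vnormE (n : nat) (v : 'cV[C]_n) : vnorm v = Num.sqrt (frob v v).
Proof.
congr Num.sqrt; apply: eq_bigr => i _.
by rewrite big_ord_recl big_ord0 addr0 -!expr2.
Qed.

Lemma vnorm_sqr (n : nat) (v : 'cV[C]_n) : vnorm v ^+ 2 = frob v v.
Proof. by rewrite vnormE sqr_sqrtr ?frob_ge0. Qed.

Lemma unitary_invmx (n : nat) (U : 'M[C]_n) : unitary n U -> invmx U = adj U.
Proof.
move=> [UU' U'U]; have uU : U \in unitmx by case/mulmx1_unit: UU'.
by rewrite -[LHS]mulmx1 -UU' mulmxA mulVmx // mul1mx.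
Qed.

Lemma unitary_frob (n p : nat) (U : 'M[C]_n) (v w : 'M[C]_(n, p)) :
  unitary n U -> frob (U *m v) (U *m w) = frob v w.
Proof. by move=> [_ U'U]; rewrite frob_mull mulmxA U'U mul1mx. Qed.

Lemma eP_involutive (n : nat) (P : 'M[C]_n) : orth_proj P -> eP P *m eP P = 1%:M.
Proof.
move=> [PP _]; rewrite /eP mulmxBl !mulmxBr mulmx1 mul1mx -scalemxAl -scalemxAr PP mulmx1.
by rewrite scalerA; apply/matrixP => i j; rewrite !mxE; ring.
Qed.

Lemma eP_hermitian (n : nat) (P : 'M[C]_n) : orth_proj P -> adj (eP P) = eP P.
Proof.
move=> [_ PP]; rewrite /eP adjD adjN adj1.
have -> : (2%:R : C) = (2%:R)%:C%C by rewrite rmorph_nat.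
by rewrite adj_realZ PP.
Qed.

End FrobeniusProduct.

(** * Least-norm elements of closed convex sets of matrices *)

Section ConvexMinimum.
Variable R : realType.
Local Notation C := (R[i]).

Lemma cvg_sumr (T J : Type) (F : set_system T) (FF : Filter F) (r : seq J)
    (f : J -> T -> R) (l : J -> R) :
  (forall j, f j @ F --> l j) ->
  (fun x => \sum_(j <- r) f j x) @ F --> \sum_(j <- r) l j.
Proof. by move=> fl; apply: cvg_big => //; exact: add_continuous. Qed.

Lemma cvg_of_sqr_dist_le (u : nat -> R) :
  (forall k l, (u k - u l) ^+ 2 <= 2 * (k.+1%:R^-1 + l.+1%:R^-1)) -> cvgn u.
Proof.
move=> ule; apply/cauchy_cvgP/cauchy_exP => e e0.
have e4 : 0 < e ^+ 2 / 4 by rewrite divr_gt0 ?exprn_gt0.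
(* Two reciprocals below [e ^+ 2 / 4] make the bound on the square smaller than [e ^+ 2]. *)
have [N _ hN] := near_infty_natSinv_lt (PosNum e4).
exists (u N), N => // k /= Nk; rewrite /ball /=.
have e_ge0 : `|e| = e by rewrite gtr0_norm.
rewrite -[ltRHS]e_ge0 -ltr_sqr ?nnegrE // !real_normK ?num_real //.
apply: (le_lt_trans (ule N k)).
have hk : k.+1%:R^-1 < e ^+ 2 / 4 := hN _ Nk.
have hN' : N.+1%:R^-1 < e ^+ 2 / 4 := hN _ (leqnn N).
by move: (k.+1%:R^-1) (N.+1%:R^-1) hk hN' => x y; lra.
Qed.

Lemma cvg_frob (p q : nat) (A B : nat -> 'M[C]_(p, q)) (A' B' : 'M[C]_(p, q)) :
  (forall i j, complex.Re (A k i j) @[k --> \oo] --> complex.Re (A' i j)) ->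
  (forall i j, complex.Im (A k i j) @[k --> \oo] --> complex.Im (A' i j)) ->
  (forall i j, complex.Re (B k i j) @[k --> \oo] --> complex.Re (B' i j)) ->
  (forall i j, complex.Im (B k i j) @[k --> \oo] --> complex.Im (B' i j)) ->
  frob (A k) (B k) @[k --> \oo] --> frob A' B'.
Proof.
move=> ra ia rb ib; rewrite /frob; apply: cvg_sumr => i; apply: cvg_sumr => j.
by apply: cvgD; apply: cvgM.
Qed.

Lemma frob_parallelogram (p q : nat) (A B : 'M[C]_(p, q)) :
  frob (A - B) (A - B) =
  2 * frob A A + 2 * frob B B
  - 4 * frob ((2^-1)%:C%C *: (A + B)) ((2^-1)%:C%C *: (A + B)).
Proof.
rewrite frobZl frobZr !frobDl !frobDr !frobNl !frobNr (frobC B A).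
by field.
Qed.

(** A closed convex set presented by affine inequalities, so that stability under midpoints and
    limits is checked one inequality at a time. *)
Definition half_spaces (p q : nat) (T : set ('M[C]_(p, q) * R)) : set 'M[C]_(p, q) :=
  [set A | forall B, T B -> B.2 <= frob B.1 A].

Lemma half_spaces_midpoint (p q : nat) (T : set ('M[C]_(p, q) * R)) A B :
  half_spaces T A -> half_spaces T B ->
  half_spaces T ((2^-1)%:C%C *: (A + B)).
Proof.
by move=> KA KB D TD; have := KA _ TD; have := KB _ TD; rewrite frobZr frobDr; lra.
Qed.

(** Midpoints stay in the set, so the parallelogram law makes a minimizing sequence Cauchy; its
    entrywise limit satisfies every inequality and attains the infimum. *)
Lemma half_spaces_min (p q : nat) (T : set ('M[C]_(p, q) * R)) :
  half_spaces T !=set0 ->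
  exists2 A, half_spaces T A & forall B, half_spaces T B -> frob A A <= frob B B.
Proof.
move=> [A0 KA0]; pose S := [set frob A A | A in half_spaces T].
have Slb : has_lbound S by exists 0 => _ [A _ <-]; exact: frob_ge0.
have Sinf : has_inf S by split => //; exists (frob A0 A0), A0.
have infS A : half_spaces T A -> inf S <= frob A A by move=> KA; apply: ge_inf => //; exists A.
have /choice[u uP] : forall k : nat, exists A, half_spaces T A /\ frob A A < inf S + k.+1%:R^-1.
  move=> k; have k0 : 0 < k.+1%:R^-1 :> R by rewrite invr_gt0.
  by have [_ [A KA <-] lt] := inf_adherent k0 Sinf; exists A.
have uu k l : frob (u k - u l) (u k - u l) <= 2 * (k.+1%:R^-1 + l.+1%:R^-1).
  rewrite frob_parallelogram.
  have [[Kk ltk] [Kl ltl]] := (uP k, uP l).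
  have := infS _ (half_spaces_midpoint Kk Kl).
  by move: (k.+1%:R^-1) (l.+1%:R^-1) ltk ltl => x y; lra.
(* Each real coordinate is dominated by the norm, which reduces convergence of [u] to convergence of
   real sequences. *)
have entry (A : 'M[C]_(p, q)) i j : complex.Re (A i j) ^+ 2 + complex.Im (A i j) ^+ 2 <= frob A A.
  have pos k l : 0 <= complex.Re (A k l) * complex.Re (A k l)
                 + complex.Im (A k l) * complex.Im (A k l).
    by rewrite -!expr2 addr_ge0 ?sqr_ge0.
  rewrite /frob (bigD1 i) //= (bigD1 j) //= -!expr2 -addrA lerDl addr_ge0 //.
    by apply: sumr_ge0 => l _.
  by apply: sumr_ge0 => k _; apply: sumr_ge0 => l _.
have cRe i j : cvgn (fun k => complex.Re (u k i j)).
  apply: cvg_of_sqr_dist_le => k l; apply: le_trans (uu k l).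
  apply: le_trans (entry _ i j); rewrite !mxE ReD.
  by case: (u l i j) => a b /=; rewrite lerDl sqr_ge0.
have cIm i j : cvgn (fun k => complex.Im (u k i j)).
  apply: cvg_of_sqr_dist_le => k l; apply: le_trans (uu k l).
  apply: le_trans (entry _ i j); rewrite !mxE ImD.
  by case: (u l i j) => a b /=; rewrite lerDr sqr_ge0.
pose L := \matrix_(i < p, j < q) (limn (fun k => complex.Re (u k i j))
    +i* limn (fun k => complex.Im (u k i j)))%C.
have uRe i j : complex.Re (u k i j) @[k --> \oo] --> complex.Re (L i j) by rewrite mxE; exact: cRe.
have uIm i j : complex.Im (u k i j) @[k --> \oo] --> complex.Im (L i j) by rewrite mxE; exact: cIm.
exists L.
  move=> B TB; have cB : frob B.1 (u k) @[k --> \oo] --> frob B.1 L.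
    by apply: (cvg_frob (A := fun=> B.1)) => // i j; exact: cvg_cst.
  by apply: (cvgr_to_ge cB); near=> k; exact: (uP k).1.
move=> B /infS; apply: le_trans.
have cL : frob (u k) (u k) @[k --> \oo] --> frob L L by exact: cvg_frob.
have cR : (inf S + k.+1%:R^-1) @[k --> \oo] --> inf S + 0.
  by apply: cvgD; [exact: cvg_cst | exact: cvg_harmonic].
rewrite -[inf S]addr0; apply: (ler_cvg_to cL cR); near=> k.
exact: ltW (uP k).2.
Unshelve. all: by end_near. Qed.

(** The midpoint of two minimizers is no shorter than they are, so the parallelogram law leaves no
    room for their difference. *)
Lemma half_spaces_min_unique (p q : nat) (T : set ('M[C]_(p, q) * R)) A B :
  half_spaces T A -> (forall D, half_spaces T D -> frob A A <= frob D D) ->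
  half_spaces T B -> frob B B = frob A A -> B = A.
Proof.
move=> KA minA KB BA; apply/eqP; rewrite -subr_eq0; apply/eqP/frob_eq0.
rewrite frob_parallelogram BA.
by have := minA _ (half_spaces_midpoint KB KA); lra.
Qed.

(* The averaging step: the element of least norm of an [H]-invariant closed convex
   set is [H]-invariant, which replaces integration over the closure of [H]. *)
Lemma invariant_hermitian (n : nat) (H : set 'M[C]_n) (c e : 'M[C]_n) (kappa : R) :
  subgroupU H -> adj e = e ->
  (forall h (v : 'cV[C]_n), H h ->
     kappa * frob v v <= frob (c *m v) (h *m e *m invmx h *m v)) ->
  exists A : 'M[C]_n, [/\ adj A = A, (forall h, H h -> h *m A = A *m h) &
    forall v : 'cV[C]_n, kappa * frob v v <= frob (c *m v) (A *m v)].
Proof.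
move=> [HU [H1 [HM HV]]] eh He.
(* [X h v] represents the real-linear functional that sends [A] to
   [frob (c *m v) (h *m A *m adj h *m v)], so the lower bound for [h] and [v] is a half-space. *)
pose X (h : 'M[C]_n) (v : 'cV[C]_n) := adj h *m (c *m v) *m adj (adj h *m v).
have XE h v A : frob (X h v) A = frob (c *m v) (h *m A *m adj h *m v).
  by rewrite /X frob_mulr frob_mull !adjK !mulmxA.
(* The first family encodes [adj A = A]: Hermitian matrices are orthogonal to all [D - adj D], and
   the choice [D = adj A - A] turns the inequality into [frob D D <= 0]. *)
pose T : set ('M[C]_n * R) := [set B | (exists D, B = (D - adj D, 0)) \/
  exists h v, H h /\ B = (X h v, kappa * frob v v)].
have KP A : half_spaces T A <-> adj A = A /\ forall h (v : 'cV[C]_n), H h ->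
    kappa * frob v v <= frob (c *m v) (h *m A *m adj h *m v).
  split=> [KA | [Ah KA] B [[D ->]|[h [v [Hh ->]]]] /=]; last 2 first.
  - by rewrite frobDl frobNl -{2}Ah frob_adj subrr.
  - by rewrite XE; exact: KA.
  split; last first.
    move=> h v Hh; rewrite -XE.
    by apply: (KA (X h v, kappa * frob v v)); right; exists h, v.
  apply/eqP; rewrite -subr_eq0; apply/eqP/frob_eq0.
  set D := adj A - A.
  have /= := KA (D - adj D, 0) (or_introl (ex_intro _ _ erefl)).
  by rewrite {4}/D frobDr frobNr -(frob_adj D (adj A)) adjK frobDl frobNl; lra.
have [A KA minA] : exists2 A, half_spaces T A & forall B, half_spaces T B -> frob A A <= frob B B.
  apply: half_spaces_min; exists e; apply/KP; split => // h v Hh.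
  by rewrite -(unitary_invmx (HU _ Hh)); exact: He.
have [Ah KA'] := (KP A).1 KA.
exists A; split => //; last first.
  by move=> v; have := KA' _ v H1; rewrite adj1 mul1mx mulmx1.
move=> g Hg; have [gg' g'g] := HU _ Hg.
(* The inequality at [h] for the conjugate by [g] is the inequality at [h *m g] for [A]. *)
have Kg : half_spaces T (g *m A *m adj g).
  apply/KP; split; first by rewrite !adjM adjK Ah mulmxA.
  move=> h v Hh; have := KA' _ v (HM _ _ Hh Hg).
  by rewrite adjM !mulmxA.
(* Conjugation by a unitary preserves the norm, so the conjugate is again a minimizer. *)
have gA : g *m A *m adj g = A.
  apply: (half_spaces_min_unique KA minA Kg).
  by rewrite frob_mulr adjK -!mulmxA g'g mulmx1 unitary_frob.
by rewrite -{2}gA -!mulmxA g'g mulmx1.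
Qed.

End ConvexMinimum.

(** * Spectral projections and comparison of ranks *)

Section SpectralProjection.
Variable R : realType.
Local Notation C := (R[i]).

(** In a unitary eigenbasis of [A], [Q] is the indicator of the nonnegative eigenvalues. The
    commutation clause lets [Q] inherit the invariance of [A]; the two sign clauses serve the
    comparison of ranks. *)
Lemma positive_spectral_projection (n : nat) (A : 'M[C]_n) : adj A = A ->
  exists Q : 'M[C]_n, [/\ orth_proj Q,
    forall X : 'M[C]_n, X *m A = A *m X -> X *m Q = Q *m X,
    forall v : 'cV[C]_n, Q *m v = v -> 0 <= frob v (A *m v) &
    forall v : 'cV[C]_n, Q *m v = 0 -> frob v (A *m v) <= 0].
Proof.
move=> Ah.
have conjE (D : 'M[C]_n) : map_mx Num.conj D^T = adj D.
  by apply/matrixP => i j; rewrite !mxE.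
have Anormal : A \is normalmx by apply/normalmxP; rewrite conjE Ah.
have /orthomx_spectralP := Anormal.
set U := spectralmx A; set d := spectral_diag A => AE.
have UU' : U *m adj U = 1%:M.
  by have /unitarymxP := spectral_unitarymx A; rewrite -/U conjE.
have U'U : adj U *m U = 1%:M := mulmx1C UU'.
have iU : invmx U = adj U by apply: unitary_invmx.
rewrite iU in AE.
(* The eigenvalues are typed as complex numbers; the sign test reads their real parts, the only
   parts that enter [frob v (A *m v)]. *)
pose s i : C := if 0 <= complex.Re (d 0 i) then 1 else 0.
pose Q := adj U *m diag_mx (\row_i s i) *m U.
have UQ (v : 'cV[C]_n) : U *m (Q *m v) = diag_mx (\row_i s i) *m (U *m v) :> 'cV_n.
  by rewrite /Q !mulmxA UU' mul1mx.
have UA (v : 'cV[C]_n) : U *m (A *m v) = diag_mx d *m (U *m v) :> 'cV_n.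
  by rewrite {1}AE !mulmxA UU' mul1mx.
have fA (v : 'cV[C]_n) : frob v (A *m v) = \sum_i complex.Re (d 0 i) *
     (complex.Re ((U *m v) i ord0) ^+ 2 + complex.Im ((U *m v) i ord0) ^+ 2).
  rewrite -(unitary_frob _ _ (conj UU' U'U)) UA /frob; apply: eq_bigr => i _.
  rewrite big_ord_recl big_ord0 addr0; move: (U *m v) => w.
  rewrite mul_diag_mx !mxE.
  by case: (d 0 i) (w i ord0) => [a b] [x y] /=; ring.
have adjs : adj (diag_mx (\row_i s i)) = diag_mx (\row_i s i).
  apply/matrixP => i j; rewrite !mxE eq_sym /s.
  case: eqP => [->|_]; last by rewrite !mulr0n /= oppr0.
  by rewrite !mulr1n; case: (0 <= _) => /=; rewrite oppr0.
exists Q; split.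
- split; last by rewrite /Q !adjM adjs adjK mulmxA.
  rewrite /Q -!mulmxA (mulmxA U) UU' mul1mx (mulmxA (diag_mx _)).
  congr (_ *m (_ *m _)).
  rewrite mulmx_diag; congr diag_mx; apply/rowP => i; rewrite !mxE /s.
  by case: (0 <= _); rewrite ?mulr1 ?mulr0.
- move=> X XA; have [Y YE] : exists Y, Y = U *m X *m adj U by exists (U *m X *m adj U).
  have Yd : Y *m diag_mx d = diag_mx d *m Y.
    have : U *m (X *m A) *m adj U = U *m (A *m X) *m adj U by rewrite XA.
    rewrite {1 2}AE !mulmxA UU' mul1mx -(mulmxA _ U (adj U)) UU' mulmx1.
    by rewrite YE !mulmxA.
  (* A nonzero entry [Y i j] forces the eigenvalues at [i] and [j] to agree, hence also their
     indicators. *)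
  have Ys : Y *m diag_mx (\row_i s i) = diag_mx (\row_i s i) *m Y.
    rewrite mul_mx_diag mul_diag_mx; apply/matrixP => i j.
    move/matrixP: Yd => /(_ i j); rewrite mul_mx_diag mul_diag_mx !mxE.
    have [->|Y0] := eqVneq (Y i j) 0; first by rewrite !mulr0 !mul0r.
    by rewrite mulrC => /(mulIf Y0) dji; rewrite mulrC /s dji.
  have : adj U *m (Y *m diag_mx (\row_i s i)) *m U =
         adj U *m (diag_mx (\row_i s i) *m Y) *m U by rewrite Ys.
  rewrite YE /Q !mulmxA U'U mul1mx => ->.
  by rewrite -[in LHS]mulmxA U'U mulmx1.
- move=> v Qv; rewrite fA; apply: sumr_ge0 => i _.
  have := congr1 (fun w : 'cV[C]_n => w i ord0) (UQ v).
  rewrite Qv; move: (U *m v) => w; rewrite mul_diag_mx !mxE /s; case: (leP 0 _) => [d0 _|d0].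
    by rewrite mulr_ge0 // addr_ge0 // sqr_ge0.
  by rewrite mul0r => ->; rewrite /= expr0n /= addr0 mulr0.
- move=> v Qv; rewrite fA; apply: sumr_le0 => i _.
  have := congr1 (fun w : 'cV[C]_n => w i ord0) (UQ v).
  rewrite Qv; move: (U *m v) => w; rewrite mulmx0 mul_diag_mx !mxE /s; case: (leP 0 _) => [d0|d0 _].
    by rewrite mul1r => <-; rewrite /= expr0n /= addr0 mulr0.
  by rewrite mulr_le0_ge0 ?(ltW d0) // addr_ge0 // sqr_ge0.
Qed.

(** Rank-nullity; transposition turns kernels on columns into the row kernels of [kermx]. *)
Lemma mxrank_le_ker (F : fieldType) (n : nat) (M N : 'M[F]_n) :
  (forall v : 'cV[F]_n, M *m v = 0 -> N *m v = 0) -> (\rank N <= \rank M)%N.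
Proof.
move=> MN; rewrite -[\rank N]mxrank_tr -[\rank M]mxrank_tr.
have : (kermx M^T <= kermx N^T)%MS.
  apply/rV_subP => u /sub_kermxP uM; apply/sub_kermxP.
  apply: trmx_inj; rewrite trmx_mul trmxK trmx0; apply: MN.
  by apply: trmx_inj; rewrite trmx_mul trmxK trmx0.
move=> /mxrankS; rewrite !mxrank_ker => h.
by rewrite -(subKn (rank_leq_row N^T)) -(subKn (rank_leq_row M^T)) leq_sub2l.
Qed.

(** If the range of [P] meets the kernel of [Q] trivially, then [Q *m P] and [P] have the same
    kernel, so the rank of [P] is at most that of [Q]. The other inequality is symmetric. *)
Lemma mxrank_idempotent_eq (F : fieldType) (n : nat) (P Q : 'M[F]_n) :
  P *m P = P -> Q *m Q = Q ->
  (forall v : 'cV[F]_n, P *m v = v -> Q *m v = 0 -> v = 0) ->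
  (forall v : 'cV[F]_n, P *m v = 0 -> Q *m v = v -> v = 0) ->
  \rank P = \rank Q.
Proof.
move=> PP QQ PQ QP; apply/eqP; rewrite eqn_leq; apply/andP; split.
  apply: leq_trans (mxrankM_maxl Q P); apply: mxrank_le_ker => v QPv.
  by apply: PQ; rewrite mulmxA ?PP.
apply: leq_trans (mxrankM_maxl P Q); apply: mxrank_le_ker => v PQv.
by apply: QP; rewrite mulmxA ?QQ.
Qed.

Lemma invariant_projection (n : nat) (H : set 'M[C]_n) (P0 e : 'M[C]_n) (kappa : R) :
  0 < kappa -> subgroupU H -> orth_proj P0 -> adj e = e ->
  (forall h (v : 'cV[C]_n), H h ->
     kappa * frob v v <= frob (eP P0 *m v) (h *m e *m invmx h *m v)) ->
  exists Q : 'M[C]_n, orth_proj Q /\ \rank Q = \rank P0 /\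
    forall h, H h -> h *m Q = Q *m h.
Proof.
move=> k0 HH [P0P0 P0h] eh He.
have [A [Ah AH cA]] := invariant_hermitian HH eh He.
have [Q [[QQ Qh] Qc Qpos Qneg]] := positive_spectral_projection Ah.
exists Q; split => //; split; last by move=> h Hh; apply: Qc; exact: AH.
have ePv (v : 'cV[C]_n) : eP P0 *m v = 2%:R *: (P0 *m v) - v :> 'cV_n.
  by rewrite /eP mulmxBl mul1mx scalemxAl.
have k0v (v : 'cV[C]_n) : kappa * frob v v <= 0 -> v = 0.
  by move=> kv; apply: frob_eq0; rewrite -(pmulr_rle0 _ k0).
(* The centre acts as [1] on the range of [P0] and as [-1] on its kernel. In both intersections the
   sign of [frob v (A *m v)] then contradicts the lower bound by [kappa] unless [v = 0]. *)
apply: esym; apply: mxrank_idempotent_eq => // v P0v Qv; apply: k0v.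
  apply: le_trans (cA v) _; rewrite ePv P0v.
  by rewrite scaler_nat mulr2n addrK; exact: Qneg.
apply: le_trans (cA v) _; rewrite ePv P0v scaler0 add0r frobNl oppr_le0.
exact: Qpos.
Qed.

End SpectralProjection.

(** * An integral bound for the angle along a real function *)

Section AngleBound.
Variable R : realType.
Local Notation mu := (@lebesgue_measure R).

(** The integral of a nonnegative function is a supremum over simple functions below it, so
    monotonicity holds for arbitrary functions, such as the speed of a curve. *)
Lemma ge0_le_integralT (d : measure_display) (T : measurableType d)
    (m : {measure set T -> \bar R}) (G F : T -> \bar R) :
  (forall x, 0 <= G x)%E -> (forall x, G x <= F x)%E ->
  (\int[m]_x G x <= \int[m]_x F x)%E.
Proof.
move=> G0 GF; have F0 x : (0 <= F x)%E := le_trans (G0 x) (GF x).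
rewrite !ge0_integralTE //; apply: ereal_sup_le => _ [h /= hG <-].
by exists h => // x; exact: le_trans (hG x) (GF x).
Qed.

Lemma partition_le (k : nat) (s : nat -> R) :
  (forall l, (l < k)%N -> s l < s l.+1) ->
  forall i j, (i <= j)%N -> (j <= k)%N -> s i <= s j.
Proof.
move=> sS i j; elim: j => [|j IH]; first by rewrite leqn0 => /eqP ->.
rewrite leq_eqVlt => /predU1P[-> // | ij] jk.
by apply: le_trans (IH _ (ltnW jk)) (ltW (sS _ jk)).
Qed.

Lemma scaled_itvoo (c f : R) : 0 <= c < 1 -> -1 <= f <= 1 -> -1 < c * f < 1.
Proof. by move=> /andP[c0 c1] /andP[f0 f1]; apply/andP; split; nra. Qed.

Lemma scaled_itvoo_sqr (c f : R) : 0 <= c < 1 -> -1 <= f <= 1 -> 0 < 1 - (c * f) ^+ 2.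
Proof.
move=> c1 f1; have /andP[h1 h2] := scaled_itvoo c1 f1.
have -> : 1 - (c * f) ^+ 2 = (1 - c * f) * (1 + c * f) by ring.
by rewrite mulr_gt0 //; lra.
Qed.

(** The left side of the conclusion is the derivative of [acos (c * f)] when [g] is that of [f].
    After squaring, the bound rests on [c ^+ 2 * (1 - f ^+ 2) <= 1 - (c * f) ^+ 2], that is on
    [c ^+ 2 <= 1]. *)
Lemma acos_angle_speed_le (c f g F : R) :
  0 <= c < 1 -> -1 <= f <= 1 -> 0 <= F -> g ^+ 2 <= F ^+ 2 * (1 - f ^+ 2) ->
  - (Num.sqrt (1 - (c * f) ^+ 2))^-1 * (c * g) <= F.
Proof.
move=> c01 f01 F0 gF; have pos := scaled_itvoo_sqr c01 f01.
case/andP: c01 => c0 c1.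
have s0 : 0 < Num.sqrt (1 - (c * f) ^+ 2) by rewrite sqrtr_gt0.
rewrite mulNr mulrC -mulNr ler_pdivrMr //.
apply: le_trans (ler_norm _) _; rewrite normrN.
rewrite -(ger0_norm (mulr_ge0 F0 (ltW s0))) -ler_sqr ?nnegrE //.
rewrite !real_normK ?num_real // [leRHS]exprMn sqr_sqrtr ?(ltW pos) //.
have h1 : c ^+ 2 * g ^+ 2 <= c ^+ 2 * (F ^+ 2 * (1 - f ^+ 2)).
  by rewrite ler_wpM2l ?sqr_ge0.
have h2 : 0 <= F ^+ 2 * (1 - c ^+ 2) by rewrite mulr_ge0 ?sqr_ge0 //; nra.
by rewrite exprMn; nra.
Qed.

(* Scaling [f] by [cos delta < 1] keeps the argument of [acos] inside the open
   interval where it is differentiable. *)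
Lemma angle_le_length (k : nat) (s : nat -> R) (f F : R -> R) (delta : R) :
  s 0%N = 0 -> s k = 1 -> (forall l, (l < k)%N -> s l < s l.+1) ->
  pw_C1_wrt k s f -> (forall t, t \in `[0, 1] -> -1 <= f t <= 1) -> f 0 = 1 ->
  (forall t, 0 <= F t) ->
  (forall l t, (l < k)%N -> t \in `]s l, s l.+1[ ->
     (derive f t 1) ^+ 2 <= F t ^+ 2 * (1 - f t ^+ 2)) ->
  0 < delta < pi / 2 ->
  ((acos (cos delta * f 1) - delta)%:E <= \int[mu]_(t in `[(0:R)%R, (1:R)%R]) (F t)%:E)%E.
Proof.
move=> s0 sk sS [fc fC1] f11 f0 F0 fF /andP[d0 d2].
pose c := cos delta.
have pi0 : 0 < pi :> R := pi_gt0 R.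
have c1 : 0 <= c < 1.
  apply/andP; split; first by apply: cos_ge0_pihalf; apply/andP; split; lra.
  rewrite -cos0 /c ltr_cos // in_itv /= ?lexx ?pi_ge0 //.
  by apply/andP; split; lra.
pose phi t := acos (c * f t).
have phi0 : phi 0 = delta.
  by rewrite /phi f0 mulr1 cosK // in_itv /=; apply/andP; split; lra.
have s01 l t : (l < k)%N -> t \in `[s l, s l.+1] -> t \in `[0, 1].
  move=> lk; rewrite !in_itv /= => /andP[tl tr]; apply/andP; split.
    by apply: le_trans tl; rewrite -s0; apply: (partition_le sS) => //; exact: ltnW.
  by apply: le_trans tr _; rewrite -sk; apply: (partition_le sS).
(* Additivity of the integral is applied to a measurable minorant [G] of [F], built one piece at a
   time. [G] vanishes outside the part already covered, so a new piece can be added without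
   overlap. *)
have minorant l : (l <= k)%N -> exists G : R -> \bar R,
    [/\ measurable_fun setT G, (forall t : R, 0 <= G t)%E,
        (forall t : R, t \in `]0%R, s l[ -> G t <= (F t)%:E)%E,
        (forall t : R, t \notin `]0%R, s l[ -> G t = 0)%E &
        ((phi (s l) - phi 0)%:E <= \int[mu]_t G t)%E].
  elim: l => [|l IH] lk.
    exists (cst 0%E); split => //.
    - by move=> t; rewrite s0 in_itv /= => /andP[h1 h2]; have := lt_trans h1 h2; rewrite ltxx.
    - by rewrite s0 subrr integral0.
  have [G [mG G0 GF Gz GI]] := IH (ltnW lk).
  have ab := sS _ lk; have [g [gc fg]] := fC1 _ lk.
  set a := s l in GF Gz GI ab gc fg *; set b := s l.+1 in ab gc fg *.
  have fc' : {within `[a, b], continuous f}.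
    by apply: continuous_subspaceW fc => t; exact: s01.
  pose psi t := - (Num.sqrt (1 - (c * f t) ^+ 2))^-1 * (c * g t).
  have f11' t : t \in `[a, b] -> -1 <= f t <= 1 by move=> tab; apply: f11; exact: (s01 l).
  have psic : {within `[a, b], continuous psi}.
    apply/subspace_continuousP => t tab.
    have ft := (subspace_continuousP _ _).1 fc' t tab.
    have gt := (subspace_continuousP _ _).1 gc t tab.
    apply: cvgM; last by apply: cvgM; [exact: cvg_cst | exact: gt].
    apply: cvgN; apply: cvgV.
      by rewrite gt_eqF // sqrtr_gt0; apply: scaled_itvoo_sqr => //; exact: f11'.
    apply: continuous_cvg; first exact: sqrt_continuous.
    apply: cvgB; first exact: cvg_cst.
    by rewrite !expr2; do 2 apply: cvgM; (try exact: cvg_cst); exact: ft.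
  have phic : {within `[a, b], continuous phi}.
    apply/subspace_continuousP => t tab.
    have ft := (subspace_continuousP _ _).1 fc' t tab.
    have cf : -1 < c * f t < 1 by apply: scaled_itvoo => //; exact: f11'.
    apply: (@cvg_comp _ _ _ (fun t => c * f t) acos _ (nbhs (c * f t))).
      by apply: cvgM; [exact: cvg_cst | exact: ft].
    exact: (continuous_acos cf).
  have phid t : t \in `]a, b[ -> is_derive t 1 phi (psi t).
    move=> tab; apply: (@is_derive1_comp _ acos (fun t => c * f t)).
      by apply: is_derive1_acos; apply: scaled_itvoo => //; apply: f11'; exact: subset_itv_oo_cc.
    exact: (is_deriveZ c (fg _ tab)).
  have psiI : (\int[mu]_(t in `[a, b]) (psi t)%:E = (phi b)%:E - (phi a)%:E)%E.
    apply: continuous_FTC2 => //.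
    - have /(continuous_within_itvP _ ab)[_ phia phib] := phic.
      by split => // t tab; have [] := phid t tab.
    - by move=> t tab; rewrite derive1E; exact: (@derive_val _ _ _ _ _ _ _ (phid t tab)).
  have mpsi : measurable_fun `]a, b[ (EFin \o psi).
    apply/measurable_EFinP; apply: measurable_funS (_ : measurable_fun `[a, b] psi) => //.
      exact: subset_itv_oo_cc.
    exact: subspace_continuous_measurable_fun.
  (* The positive part keeps the minorant nonnegative, and its integral is at least that of [psi],
     the increment of [phi]. *)
  pose G' := (((EFin \o psi)^\+)%E \_ `]a, b[)%classic : R -> \bar R.
  have mG' : measurable_fun setT G'.
    apply/(measurable_restrictT _ _).1 => //; exact: measurable_funepos.
  have G'0 t : (0 <= G' t)%E by apply: erestrict_ge0 => x _; exact: funepos_ge0.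
  have a0 : 0 <= a by rewrite -s0; apply: (partition_le sS) => //; exact: ltnW.
  exists (fun t => G t + G' t)%E; split.
  - exact: emeasurable_funD.
  - by move=> t; rewrite adde_ge0.
  (* At most one summand is nonzero at each [t]; at the breakpoint [a] both vanish. *)
  - move=> t; rewrite in_itv /= => /andP[t0 tb]; rewrite /G' patchE.
    case: ifPn; rewrite ?inE /= => tab.
      rewrite Gz ?add0e; last first.
        by rewrite in_itv /= negb_and -!leNgt (itvP tab) orbT.
      rewrite funeposE ge_max lee_fin; apply/andP; split; last by rewrite lee_fin.
      apply: acos_angle_speed_le => //.
        by apply: f11; apply: (s01 l) => //; exact: subset_itv_oo_cc.
      by have := fF _ _ lk tab; rewrite (@derive_val _ _ _ _ _ _ _ (fg _ tab)).
    rewrite adde0; have [ta|ta] := ltP t a; first by apply: GF; rewrite in_itv /= t0.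
    by rewrite Gz ?lee_fin // in_itv /= negb_and -!leNgt ta orbT.
  - move=> t tb; rewrite Gz ?add0e /G' ?patchE.
      case: ifPn => //; rewrite inE /= => tab; case/negP: tb.
      by rewrite in_itv /= (le_lt_trans a0) ?(itvP tab).
    apply: contra tb; rewrite !in_itv /= => /andP[-> /lt_trans]; exact.
  - rewrite ge0_integralD //.
    have -> : (phi b - phi 0)%:E = ((phi a - phi 0)%:E + (phi b - phi a)%:E)%E.
      by rewrite -EFinD; congr EFin; ring.
    apply: leeD => //; rewrite /G' -integral_mkcond.
    rewrite EFinB -psiI (integral_itv_bndoo _ _ mpsi) [leLHS]integralE.
    rewrite -[leRHS]adde0; apply: leeD => //; rewrite oppe_le0.
    by apply: integral_ge0 => t _; exact: funeneg_ge0.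
have [G [_ G0 GF Gz GI]] := minorant _ (leqnn k).
rewrite sk in GF Gz GI; rewrite -/c -/(phi 1) -[delta]phi0; apply: le_trans GI _.
rewrite [leRHS]integral_mkcond; apply: ge0_le_integralT => // t.
rewrite patchE; case: ifPn; rewrite ?inE /= => t01.
  have [/GF//|/Gz ->] := boolP (t \in `]0, 1[); exact: F0.
rewrite Gz //; apply: contra t01 => t01; rewrite inE; exact: subset_itv_oo_cc t01.
Qed.

End AngleBound.

(** * Lengths of unitary curves and angles between vectors *)

Section Curves.
Variable R : realType.
Local Notation C := (R[i]).

Lemma frob_cauchy_schwarz (p q : nat) (A B : 'M[C]_(p, q)) :
  frob A B ^+ 2 <= frob A A * frob B B.
Proof.
have [B0|B0] := leP (frob B B) 0.
  by rewrite (frob_eq0 B0) !frob0r expr0n /= mulr0.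
set x := frob A B.
(* The test matrix is [frob B B] times the component of [A] orthogonal to [B]. *)
have := frob_ge0 ((frob B B)%:C%C *: A - x%:C%C *: B).
rewrite !frobDl !frobDr !frobNl !frobNr !frobZl !frobZr (frobC B A) -/x.
rewrite (_ : _ - _ + _ = frob B B * (frob A A * frob B B - x ^+ 2)); last by ring.
by rewrite pmulr_rge0 // subr_ge0.
Qed.

Lemma frob_unit_le1 (p q : nat) (A B : 'M[C]_(p, q)) :
  frob A A = 1 -> frob B B = 1 -> -1 <= frob A B <= 1.
Proof.
move=> A1 B1; rewrite -ler_norml -(ler_sqr (x := `|_|)) ?nnegrE //.
by rewrite real_normK ?num_real // expr1n; have := frob_cauchy_schwarz A B; rewrite A1 B1 mul1r.
Qed.

Lemma adj_mul_self (n : nat) (v : 'cV[C]_n) : adj v *m v = ((frob v v)%:C%C)%:M.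
Proof.
apply/matrixP => i j; rewrite !ord1 !mxE eqxx mulr1n rmorph_sum.
apply: eq_bigr => k _; rewrite big_ord_recl big_ord0 addr0 !mxE.
case: (v k ord0) => [a b]; apply/eqP; rewrite eq_complex /=.
by apply/andP; split; apply/eqP; ring.
Qed.

(** Cauchy-Schwarz against the rank-one matrix [A *m v *m adj v]. This bounds the set in [opnorm],
    as needed for its [sup] to be an upper bound. *)
Lemma frob_mul_unit_le (n : nat) (A : 'M[C]_n) (v : 'cV[C]_n) :
  frob v v = 1 -> frob (A *m v) (A *m v) <= frob A A.
Proof.
move=> v1; set x := frob (A *m v) (A *m v).
have x0 : 0 <= x := frob_ge0 _.
have e1 : frob A (A *m v *m adj v) = x by rewrite frobC frob_mulr adjK.
have e2 : frob (A *m v *m adj v) (A *m v *m adj v) = x.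
  by rewrite frob_mulr adjK -mulmxA adj_mul_self v1 mulmx1.
have := frob_cauchy_schwarz A (A *m v *m adj v); rewrite e1 e2 expr2.
have [->|xn0] := eqVneq x 0; first by rewrite frob_ge0.
by rewrite ler_pM2r // lt_neqAle eq_sym xn0.
Qed.

Lemma vnorm1 (n : nat) (v : 'cV[C]_n) : vnorm v = 1 -> frob v v = 1.
Proof. by move=> v1; rewrite -vnorm_sqr v1 expr1n. Qed.

Lemma vnorm_le_opnorm (n : nat) (A : 'M[C]_n) (v : 'cV[C]_n) :
  frob v v = 1 -> vnorm (A *m v) <= opnorm A.
Proof.
move=> v1; apply: sup_upper_bound; last first.
  by exists v => //=; rewrite vnormE v1 sqrtr1.
split; first by exists (vnorm (A *m v)), v => //=; rewrite vnormE v1 sqrtr1.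
exists (Num.sqrt (frob A A)) => _ [w /= w1 <-].
by rewrite vnormE ler_sqrt ?frob_ge0 //; apply: frob_mul_unit_le; exact: vnorm1.
Qed.

Lemma is_derive_frob (n : nat) (B : 'M[C]_n) (alpha : R -> 'M[C]_n) (t : R) :
  (forall i j, derivable (re_coord alpha i j) t 1 /\ derivable (im_coord alpha i j) t 1) ->
  is_derive t 1 (fun x => frob B (alpha x)) (frob B (dcurve alpha t)).
Proof.
move=> dalpha.
have -> : (fun x => frob B (alpha x)) = \sum_(i < n) \sum_(j < n)
    (complex.Re (B i j) \*: re_coord alpha i j + complex.Im (B i j) \*: im_coord alpha i j).
  apply/funext => x; rewrite fct_sumE; apply: eq_bigr => i _.
  by rewrite fct_sumE; apply: eq_bigr.
rewrite /frob; apply: is_derive_sum => i; apply: is_derive_sum => j.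
have [dr di] := dalpha i j; rewrite !mxE /=.
by apply: is_deriveD; apply: is_deriveZ; apply: derivableP.
Qed.

Lemma pw_C1_wrt_lin (k : nat) (s : nat -> R) (a b : R) (f g : R -> R) :
  pw_C1_wrt k s f -> pw_C1_wrt k s g -> pw_C1_wrt k s (fun t => a * f t + b * g t).
Proof.
move=> [fc fd] [gc gd]; split.
  move=> x; apply: cvgD; apply: cvgM; (try exact: cvg_cst); [exact: fc | exact: gc].
move=> l lk; have [f' [f'c ff']] := fd l lk; have [g' [g'c gg']] := gd l lk.
exists (fun t => a * f' t + b * g' t); split.
  move=> x; apply: cvgD; apply: cvgM; (try exact: cvg_cst); [exact: f'c | exact: g'c].
move=> t tl; apply: (@is_deriveD _ _ _ (a \*: f) (b \*: g)); apply: is_deriveZ.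
  exact: ff'.
exact: gg'.
Qed.

Lemma pw_C1_wrt_sum (k : nat) (s : nat -> R) (J : Type) (r : seq J) (h : J -> R -> R) :
  (forall j, pw_C1_wrt k s (h j)) -> pw_C1_wrt k s (fun t => \sum_(j <- r) h j t).
Proof.
move=> hC1; elim: r => [|j r IH].
  under eq_fun do rewrite big_nil; split; first by move=> x; exact: cvg_cst.
  move=> l lk; exists (cst 0); split; first by move=> x; exact: cvg_cst.
  by move=> t _; exact: is_derive_cst.
under eq_fun do rewrite big_cons -[h j _]mul1r -[X in _ + X]mul1r.
exact: pw_C1_wrt_lin.
Qed.

(** The functional [frob (w *m adj v)] reads off [f], the product of [w] with the point
    [y = alpha t *m v] of the unit sphere. The velocity is orthogonal to [y], so [w] may be replaced
    by [w - f y], of squared norm [1 - f ^+ 2], before applying Cauchy-Schwarz. *)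
Lemma curve_speed_le (n : nat) (alpha : R -> 'M[C]_n) (a b t : R) (v w : 'cV[C]_n) :
  (forall x, x \in `]a, b[ -> unitary n (alpha x)) ->
  (forall x i j, x \in `]a, b[ ->
    derivable (re_coord alpha i j) x 1 /\ derivable (im_coord alpha i j) x 1) ->
  t \in `]a, b[ -> frob v v = 1 -> frob w w = 1 ->
  (derive (fun x => frob (w *m adj v) (alpha x)) t 1) ^+ 2
    <= opnorm (dcurve alpha t) ^+ 2 * (1 - frob (w *m adj v) (alpha t) ^+ 2).
Proof.
move=> aU ad tab v1 w1.
have dfrob B x : x \in `]a, b[ ->
    is_derive x 1 (fun x => frob B (alpha x)) (frob B (dcurve alpha x)).
  by move=> xab; apply: is_derive_frob => i j; exact: ad.
rewrite (@derive_val _ _ _ _ _ _ _ (dfrob _ _ tab)) !frob_mulr adjK.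
set D := dcurve alpha t *m v; set y := alpha t *m v; set f := frob w y.
have y1 : frob y y = 1 by rewrite unitary_frob ?v1 //; exact: aU.
have ab : a <= b by move: tab; rewrite in_itv /= => /andP[/ltW/le_trans at_ /ltW]; exact: at_.
(* [frob y (alpha x *m v)] is maximal at [x = t], so its derivative vanishes there. *)
have yD : frob y D = 0.
  have <- : frob (y *m adj v) (dcurve alpha t) = frob y D by rewrite frob_mulr adjK.
  have <- := @derive_val _ _ _ _ _ _ _ (dfrob (y *m adj v) _ tab).
  apply: (@derive_val _ _ _ _ _ _ _ (derive1_at_max ab _ tab _)).
    by move=> x xab; have [] := dfrob (y *m adj v) x xab.
  move=> x xab; rewrite !(frob_mulr (adj v)) adjK -/y y1.
  have x1 : frob (alpha x *m v) (alpha x *m v) = 1 by rewrite unitary_frob ?v1 //; exact: aU.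
  by have /andP[] := frob_unit_le1 y1 x1.
have -> : frob w D = frob (w - f%:C%C *: y) D.
  by rewrite frobDl frobNl frobZl yD mulr0 subr0.
apply: le_trans (frob_cauchy_schwarz _ _) _; rewrite mulrC.
have -> : frob (w - f%:C%C *: y) (w - f%:C%C *: y) = 1 - f ^+ 2.
  rewrite !frobDl !frobDr !frobNl !frobNr !frobZl !frobZr (frobC y w) -/f w1 y1.
  by ring.
apply: ler_wpM2r.
  have /andP[] := frob_unit_le1 w1 y1; rewrite -/f => ? ?; nra.
by rewrite -vnorm_sqr ler_pXn2r ?nnegrE ?sqrtr_ge0 ?vnorm_le_opnorm //
  (le_trans (sqrtr_ge0 _) (vnorm_le_opnorm _ v1)).
Qed.

(** The cosine of the angle between [u *m v] and [alpha t *m v] satisfies the differential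
    inequality of [angle_le_length], with [F] the operator norm of the velocity. *)
Lemma angle_le_curve_length (n : nat) (alpha : R -> 'M[C]_n) (u u' : 'M[C]_n)
    (v : 'cV[C]_n) (delta : R) :
  pw_smooth_curve alpha u u' -> frob v v = 1 -> 0 < delta < pi / 2 ->
  ((acos (cos delta * frob (u *m v) (u' *m v)) - delta)%:E <= curve_length alpha)%E.
Proof.
move=> [a0 [a1 [aU [k [s [s0 [sk [sS aC1]]]]]]]] v1 d.
have U01 t : t \in `[0, 1] -> frob (alpha t *m v) (alpha t *m v) = 1.
  by move=> t01; rewrite unitary_frob ?v1 //; exact: aU.
have u1 : frob (u *m v) (u *m v) = 1.
  by rewrite -a0; apply: U01; rewrite in_itv /= lexx ler01.
have fE t : frob (u *m v *m adj v) (alpha t) = frob (u *m v) (alpha t *m v).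
  by rewrite frob_mulr adjK.
have -> : frob (u *m v) (u' *m v) = frob (u *m v *m adj v) (alpha 1) by rewrite fE a1.
apply: (@angle_le_length _ k s (fun t => frob (u *m v *m adj v) (alpha t))) => //.
- apply: pw_C1_wrt_sum => i; apply: pw_C1_wrt_sum => j.
  have [? ?] := aC1 i j; exact: (pw_C1_wrt_lin _ _ (f := re_coord alpha i j)).
- by move=> t t01; rewrite fE; apply: frob_unit_le1 => //; exact: U01.
- by rewrite fE a0.
- by move=> t; apply: le_trans (vnorm_le_opnorm _ v1); exact: sqrtr_ge0.
- move=> l t lk tl.
  have s01 x : x \in `]s l, s l.+1[ -> x \in `[0, 1].
    rewrite !in_itv /= => /andP[xl xr]; apply/andP; split.
      by apply: le_trans (ltW xl); rewrite -s0; apply: (partition_le sS) => //; exact: ltnW.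
    by apply: le_trans (ltW xr) _; rewrite -sk; apply: (partition_le sS).
  apply: (@curve_speed_le _ _ (s l) (s l.+1)) => //.
    by move=> x xl; apply: aU; exact: s01.
  move=> x i j xl; have [[_ /(_ l lk)[g [_ gd]]] [_ /(_ l lk)[h [_ hd]]]] := aC1 i j.
  by split; [have [] := gd x xl | have [] := hd x xl].
Qed.

Lemma dinf_lt_cos_le (n : nat) (u u' : 'M[C]_n) (r r' : R) (v : 'cV[C]_n) :
  (dinf u u' < r%:E)%E -> 0 < r -> r < r' -> r' < pi / 2 ->
  cos r' * frob v v <= frob (u *m v) (u' *m v).
Proof.
move=> /ereal_inf_lt[_ [alpha [aP ->]] len] r0 rr' r'2.
(* Both sides are homogeneous of degree two in [v]. *)
wlog v1 : v / frob v v = 1.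
  move=> unit_case; have [v0|v0] := leP (frob v v) 0.
    by rewrite (frob_eq0 v0) !mulmx0 !frob0r mulr0.
  have s0 : 0 < Num.sqrt (frob v v) by rewrite sqrtr_gt0.
  have [w [q [-> w1]]] : exists (w : 'cV[C]_n) (q : R), v = q%:C%C *: w /\ frob w w = 1.
    exists (((Num.sqrt (frob v v))^-1)%:C%C *: v), (Num.sqrt (frob v v)); split.
      by rewrite scalerA -rmorphM /= mulfV ?gt_eqF // scale1r.
    rewrite frobZl frobZr mulrA -invfM -expr2 sqr_sqrtr ?(ltW v0) //.
    by rewrite mulVf // gt_eqF.
  have := unit_case w w1; rewrite -!scalemxAr !frobZl !frobZr w1 !mulr1 => h.
  by rewrite mulrC mulrA -expr2 ler_wpM2l ?sqr_ge0.
rewrite v1 mulr1; set x := frob _ _.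
(* With slack [delta = r' - r], a length below [r] bounds the scaled angle by [r']. *)
have d : 0 < r' - r < pi / 2 by apply/andP; split; lra.
have := le_lt_trans (angle_le_curve_length aP v1 d) len.
rewrite lte_fin -/x => lt_r'.
have [a0 [a1 [aU _]]] := aP.
have uU : unitary n u by rewrite -a0; apply: aU; rewrite in_itv /= lexx ler01.
have u'U : unitary n u' by rewrite -a1; apply: aU; rewrite in_itv /= lexx ler01.
have x1 : -1 <= x <= 1 by apply: frob_unit_le1; rewrite unitary_frob.
set c := cos (r' - r) in lt_r'.
have c01 : 0 <= c <= 1.
  by rewrite cos_le1 andbT; apply: cos_ge0_pihalf; apply/andP; split; lra.
have cx1 : -1 <= c * x <= 1.
  by case/andP: c01 => ? ?; case/andP: x1 => ? ?; apply/andP; split; nra.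
have [/andP[acos0 acospi] cosacos] := acos_def cx1.
have pi0 : 0 < pi :> R := pi_gt0 R.
have cosr' : 0 < cos r' by apply: cos_gt0_pihalf; apply/andP; split; lra.
(* [cos] decreases on [[0, pi]]. As [cos r'] is positive, so is [x], and [c <= 1] then gives
   [cos r' <= x]. *)
have : cos r' < c * x.
  rewrite -cosacos ltr_cos ?in_itv /=; [lra | |]; apply/andP; split; lra.
by case/andP: c01 => ? ?; nra.
Qed.

End Curves.

(** * From small radius to an invariant projection *)

Section Radius.
Variable R : realType.
Local Notation C := (R[i]).

(** The rank [m] of [Q] comes from the projection [P0] behind the centre of a ball that contains the
    orbit. *)
Lemma radius_lt_invariant_projection (m n : nat) (H : set 'M[C]_n) (P : 'M[C]_n) :
  subgroupU H -> orth_proj P ->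
  (radius_inf m (conj_orbit H (eP P)) < (pi / 2 : R)%:E)%E ->
  exists Q : 'M[C]_n, orth_proj Q /\ \rank Q = m /\
    forall h, H h -> h *m Q = Q *m h.
Proof.
move=> HH PP /ereal_inf_lt[_ [r [_ [[P0 [P0P [<- ->]]] cr]] <-]].
rewrite lte_fin => r2; have pi0 : 0 < pi :> R := pi_gt0 R.
(* [r1] turns [dinf <= r] into a strict bound by a positive number; [r'] leaves room for the slack
   in the angle estimate. *)
pose r1 := (Num.max r 0 + pi / 2) / 2; pose r' := (r1 + pi / 2) / 2.
have [rm rp] : r <= Num.max r 0 /\ 0 <= Num.max r 0 by rewrite !le_max !lexx orbT.
have mx2 : Num.max r 0 < pi / 2 by rewrite gt_max r2 divr_gt0.
have [r1r r10 r1r' r'2] : [/\ r < r1, 0 < r1, r1 < r' & r' < pi / 2].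
  by rewrite /r' /r1; split; lra.
have k0 : 0 < cos r' by apply: cos_gt0_pihalf; apply/andP; split; lra.
apply: (invariant_projection k0 HH P0P (eP_hermitian PP)) => h v Hh.
apply: (@dinf_lt_cos_le _ _ _ _ r1) => //.
by apply: le_lt_trans (cr _ _) _; [exists h | rewrite lte_fin].
Qed.

End Radius.

(** * Quarter circles between anticommuting reflections *)

Section QuarterTurn.
Variable R : realType.
Local Notation C := (R[i]).

Lemma is_derive_quarter (a b t : R) :
  is_derive t 1 (fun x => cos (pi / 2 * x) * a + sin (pi / 2 * x) * b)
    (pi / 2 * (cos (pi / 2 * t) * b - sin (pi / 2 * t) * a)).
Proof.
have dl : is_derive t 1 (fun x : R => pi / 2 * x) (pi / 2).
  have := is_deriveZ (pi / 2) (is_derive_id t (1 : R)).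
  by rewrite /GRing.scale /= mulr1.
have dc := is_derive1_comp (is_derive_cos (pi / 2 * t)) dl.
have ds := is_derive1_comp (is_derive_sin (pi / 2 * t)) dl.
have := is_deriveD (is_deriveZ a dc) (is_deriveZ b ds).
set g := (X in is_derive _ _ X _) => dg.
have -> : (fun x => cos (pi / 2 * x) * a + sin (pi / 2 * x) * b) = g.
  by apply/funext => x; rewrite /g /= mulrC [X in _ + X]mulrC.
apply: (is_derive_eq dg); rewrite /GRing.scale /=; ring.
Qed.

Lemma quarter_C1 (a b : R) :
  pw_C1_wrt 1 (fun l => l%:R) (fun x => cos (pi / 2 * x) * a + sin (pi / 2 * x) * b).
Proof.
have cont (c d : R) : continuous (fun x => cos (pi / 2 * x) * c + sin (pi / 2 * x) * d).
  move=> x; apply: differentiable_continuous; apply/derivable1_diffP.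
  by have [] := is_derive_quarter c d x.
split; first exact: continuous_subspaceT.
case=> // _; exists (fun t => pi / 2 * (cos (pi / 2 * t) * b - sin (pi / 2 * t) * a)); split.
  apply: continuous_subspaceT => x; apply: cvgM; first exact: cvg_cst.
  have := cont b (- a) x; rewrite /continuous_at mulrN.
  by under eq_fun do rewrite mulrN.
by move=> t _; exact: is_derive_quarter.
Qed.

Lemma opnorm_unitary (n : nat) (a : R) (U : 'M[C]_n.+1) :
  0 <= a -> unitary n.+1 U -> opnorm (a%:C%C *: U) = a.
Proof.
move=> a0 UU; have aU v : frob v v = 1 -> vnorm (a%:C%C *: U *m v) = a.
  move=> v1; rewrite vnormE -scalemxAl frobZl frobZr unitary_frob // v1 mulr1.
  by rewrite -expr2 sqrtr_sqr ger0_norm.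
rewrite /opnorm (_ : [set _ | _ in _] = [set a]) ?sup1 //.
apply/seteqP; split => [_ [v /= v1 <-] | _ ->] /=.
  by apply: aU; exact: vnorm1.
have e1 : frob (delta_mx ord0 ord0 : 'cV[C]_n.+1) (delta_mx ord0 ord0) = 1.
  rewrite /frob (bigD1 ord0) //= big_ord_recl big_ord0 addr0 !mxE /= big1 ?addr0.
    by rewrite mulr1 mulr0 addr0.
  move=> i i0; rewrite big_ord_recl big_ord0 !mxE (negbTE i0) /=.
  by rewrite !mulr0 !addr0.
exists (delta_mx ord0 ord0); last exact: aU.
by rewrite /= vnormE e1 sqrtr1.
Qed.

(** Anticommutation cancels the cross terms of the square, so the combination is a Hermitian
    involution. *)
Lemma anticommuting_unitary (n : nat) (A B : 'M[C]_n) (a b : R) :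
  adj A = A -> adj B = B -> A *m A = 1%:M -> B *m B = 1%:M ->
  A *m B = - (B *m A) -> a ^+ 2 + b ^+ 2 = 1 ->
  unitary n (a%:C%C *: A + b%:C%C *: B).
Proof.
move=> Ah Bh AA BB AB ab1; set U := _ + _.
have Uh : adj U = U by rewrite /U adjD !adj_realZ Ah Bh.
have UU : U *m U = 1%:M.
  rewrite /U mulmxDl !mulmxDr -!scalemxAl -!scalemxAr AA BB AB !scalerA.
  rewrite scalerN (mulrC b%:C%C) [X in _ + X]addrC addrACA -!rmorphM /=.
  rewrite addNr addr0 -scalerDl -rmorphD /=.
  by rewrite -!expr2 ab1 scale1r.
by split; rewrite Uh.
Qed.

(** The path [cos A + sin B] stays unitary, and its velocity is [pi / 2] times a unitary of the same
    form, so its length is [pi / 2]. The size [n.+1] provides the unit vector that the [sup] in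
    [opnorm] requires. *)
Lemma dinf_anticommuting_le (n : nat) (A B : 'M[C]_n.+1) :
  adj A = A -> adj B = B -> A *m A = 1%:M -> B *m B = 1%:M ->
  A *m B = - (B *m A) -> (dinf A B <= (pi / 2 : R)%:E)%E.
Proof.
move=> Ah Bh AA BB AB; have pi0 : 0 <= pi / 2 :> R by rewrite divr_ge0 ?pi_ge0.
pose alpha (t : R) := (cos (pi / 2 * t))%:C%C *: A + (sin (pi / 2 * t))%:C%C *: B.
have reE i j : re_coord alpha i j = fun x => cos (pi / 2 * x) * complex.Re (A i j)
    + sin (pi / 2 * x) * complex.Re (B i j).
  apply/funext => x; rewrite /re_coord !mxE.
  by case: (A i j) (B i j) => [a b] [c d] /=; rewrite !mul0r !subr0.
have imE i j : im_coord alpha i j = fun x => cos (pi / 2 * x) * complex.Im (A i j)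
    + sin (pi / 2 * x) * complex.Im (B i j).
  apply/funext => x; rewrite /im_coord !mxE.
  by case: (A i j) (B i j) => [a b] [c d] /=; rewrite !mul0r !addr0.
apply: ereal_inf_lbound; exists alpha; split.
  split; first by rewrite /alpha mulr0 cos0 sin0 scale1r scale0r addr0.
  split; first by rewrite /alpha mulr1 cos_pihalf sin_pihalf scale1r scale0r add0r.
  split; first by move=> t _; apply: anticommuting_unitary => //; exact: cos2Dsin2.
  exists 1%N, (fun l => l%:R); split => //; split => //; split; first by case.
  by move=> i j; rewrite reE imE; split; exact: quarter_C1.
rewrite /curve_length.
have speed t : opnorm (dcurve alpha t) = pi / 2.
  have -> : dcurve alpha t = (pi / 2)%:C%C *:
      ((- sin (pi / 2 * t))%:C%C *: A + (cos (pi / 2 * t))%:C%C *: B).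
    apply/matrixP => i j; rewrite !mxE reE imE.
    rewrite !(@derive_val _ _ _ _ _ _ _ (is_derive_quarter _ _ _)).
    case: (A i j) (B i j) => [a b] [c d]; apply/eqP; rewrite eq_complex /=.
    by apply/andP; split; apply/eqP; ring.
  apply: opnorm_unitary => //; apply: anticommuting_unitary => //.
  by rewrite sqrrN addrC cos2Dsin2.
under eq_integral do rewrite speed.
rewrite integral_cst //= lebesgue_measure_itv /= lte_fin ltr01.
by rewrite -EFinD oppr0 addr0 mule1.
Qed.

End QuarterTurn.

(** * The Pauli example for optimality *)

Section PauliExample.
Variable R : realType.
Local Notation C := (R[i]).

Definition pauliX : 'M[C]_2 := \matrix_(i, j) (i != j)%:R.
Definition pauliZ : 'M[C]_2 := eP (delta_mx 0 0).

Definition pauliZ_normalizer : set 'M[C]_2 :=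
  [set h | unitary 2 h /\ (h *m pauliZ = pauliZ *m h \/ h *m pauliZ = - (pauliZ *m h))].

Lemma matrix2P (A B : 'M[C]_2) :
  A 0 0 = B 0 0 -> A 0 1 = B 0 1 -> A 1 0 = B 1 0 -> A 1 1 = B 1 1 -> A = B.
Proof.
move=> h00 h01 h10 h11; apply/matrixP.
have I2 (i : 'I_2) : i = 0 \/ i = 1.
  by case: i => [[|[|//]] h]; [left | right]; exact: val_inj.
by move=> i j; case: (I2 i) => ->; case: (I2 j) => ->.
Qed.

Lemma orth_proj_delta : orth_proj (delta_mx 0 0 : 'M[C]_2).
Proof.
split; first by rewrite mul_delta_mx.
by apply: matrix2P; rewrite !mxE /= ?oppr0.
Qed.

Lemma pauliZ_hermitian : adj pauliZ = pauliZ.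
Proof. exact: eP_hermitian orth_proj_delta. Qed.

Lemma pauliZ_sqr : pauliZ *m pauliZ = 1%:M.
Proof. exact: eP_involutive orth_proj_delta. Qed.

Lemma pauliX_hermitian : adj pauliX = pauliX.
Proof. by apply: matrix2P; rewrite !mxE /= ?oppr0. Qed.

Lemma pauliX_sqr : pauliX *m pauliX = 1%:M.
Proof. by apply: matrix2P; rewrite !mxE !big_ord_recl big_ord0 !mxE /=; ring. Qed.

Lemma pauliXZ : pauliX *m pauliZ = - (pauliZ *m pauliX).
Proof. by apply: matrix2P; rewrite !mxE !big_ord_recl !big_ord0 !mxE /=; ring. Qed.

Lemma pauliX_Grass : Grass 1 2 pauliX.
Proof.
(* The projection onto the line spanned by [(1, 1)], the eigenspace of [pauliX] for the eigenvalue
   [1]. *)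
exists (const_mx 2^-1); split; last split.
- split.
    by apply: matrix2P; rewrite !mxE !big_ord_recl big_ord0 !mxE; field.
  have -> : const_mx 2^-1 = (2^-1)%:C%C *: const_mx 1 :> 'M[C]_2.
    by apply/matrixP => i j; rewrite !mxE mulr1 rmorphV ?unitfE ?pnatr_eq0 // rmorph_nat.
  by rewrite adj_realZ; congr (_ *: _); apply/matrixP => i j; rewrite !mxE /= oppr0.
- apply/eqP; rewrite eqn_leq lt0n mxrank_eq0; apply/andP; split.
    have -> : const_mx 2^-1 = (const_mx 1 : 'cV[C]_2) *m (const_mx 2^-1 : 'rV[C]_2).
      by apply/matrixP => i j; rewrite !mxE big_ord_recl big_ord0 !mxE mul1r addr0.
    by apply: leq_trans (mxrankM_maxr _ _) (rank_leq_row _).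
  apply/eqP => /matrixP/(_ 0 0); rewrite !mxE => /eqP.
  by rewrite invr_eq0 pnatr_eq0.
- by apply: matrix2P; rewrite !mxE /=; field.
Qed.

Lemma pauliZ_normalizer_subgroup : subgroupU pauliZ_normalizer.
Proof.
have unit1 : unitary 2 (1%:M : 'M[C]_2) by split; rewrite adj1 mulmx1.
split; first by move=> h [].
split; first by split => //; left; rewrite mul1mx mulmx1.
split.
  move=> g h [[g1 g2] gZ] [[h1 h2] hZ]; split.
    split; rewrite adjM -mulmxA.
      by rewrite (mulmxA h) h1 mul1mx g1.
    by rewrite (mulmxA _ g) g2 mul1mx h2.
  case: gZ => gZ; case: hZ => hZ; [left | right | right | left];
    by rewrite -mulmxA hZ ?mulmxN (mulmxA g) gZ ?mulNmx ?opprK mulmxA.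
move=> h [hU hZ]; rewrite unitary_invmx //; have [h1 h2] := hU.
split; first by split; rewrite adjK.
have E : adj h *m (pauliZ *m h) *m adj h = adj h *m pauliZ.
  by rewrite -!mulmxA h1 mulmx1.
have E' : adj h *m (h *m pauliZ) *m adj h = pauliZ *m adj h.
  by rewrite mulmxA h2 mul1mx.
case: hZ => hZ; rewrite hZ ?mulmxN ?mulNmx E in E'; first by left.
by right; rewrite -E' opprK.
Qed.

Lemma pauliZ_normalizer_orbit a :
  conj_orbit pauliZ_normalizer pauliZ a -> a = pauliZ \/ a = - pauliZ.
Proof.
move=> [h [hU hZ] <-]; rewrite unitary_invmx //; have [h1 h2] := hU.
by case: hZ => ->; [left | right]; rewrite ?mulNmx -mulmxA h1 mulmx1.
Qed.

(** Commuting with [pauliZ] kills the off-diagonal entries and commuting with [pauliX] equates the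
    diagonal ones, so [Q] is scalar, of rank [0] or [2]. *)
Lemma pauliZ_normalizer_irreducible (Q : 'M[C]_2) :
  (forall h, pauliZ_normalizer h -> h *m Q = Q *m h) -> \rank Q <> 1%N.
Proof.
move=> HQ.
have ZQ : pauliZ *m Q = Q *m pauliZ.
  apply: HQ; split; last by left.
  by split; rewrite pauliZ_hermitian pauliZ_sqr.
have XQ : pauliX *m Q = Q *m pauliX.
  apply: HQ; split; last by right; exact: pauliXZ.
  by split; rewrite pauliX_hermitian pauliX_sqr.
have e i j := congr1 (fun M : 'M[C]_2 => M i j) ZQ.
have e' i j := congr1 (fun M : 'M[C]_2 => M i j) XQ.
have l1 : lift ord0 ord0 = 1 :> 'I_2 by exact: val_inj.
have l0 : ord0 = 0 :> 'I_2 by exact: val_inj.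
have double0 (x : C) : 2 * x = 0 -> x = 0.
  by move/eqP; rewrite mulf_eq0 pnatr_eq0 => /eqP.
have Q01 : Q 0 1 = 0.
  have /eqP := e 0 1; rewrite !mxE !big_ord_recl !big_ord0 !mxE /= !l1 !l0 -subr_eq0.
  by move=> /eqP h; apply: double0; rewrite -h; ring.
have Q10 : Q 1 0 = 0.
  have /eqP := e 1 0; rewrite !mxE !big_ord_recl !big_ord0 !mxE /= !l1 !l0 -subr_eq0.
  by move=> /eqP h; apply: double0; rewrite -[RHS]oppr0 -h; ring.
have Q11 : Q 1 1 = Q 0 0.
  have /eqP := e' 0 1; rewrite !mxE !big_ord_recl !big_ord0 !mxE /= !l1 !l0 -subr_eq0.
  by move=> /eqP h; apply/eqP; rewrite -subr_eq0; apply/eqP; rewrite -[RHS]h; ring.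
have -> : Q = (Q 0 0) *: 1%:M.
  by apply: matrix2P; rewrite !mxE /= ?mulr1 ?mulr0.
have [->|Q0] := eqVneq (Q 0 0) 0; first by rewrite scale0r mxrank0.
by rewrite (eqmx_scale _ Q0) mxrank1.
Qed.

End PauliExample.

Theorem theorem5p4 (R : realType) :
  (forall (m n : nat), (0 < m)%N -> (m < n)%N ->
   forall H : set 'M[R[i]]_n, subgroupU H ->
   (exists P : 'M[R[i]]_n, orth_proj P /\ \rank P = m /\
      (radius_inf m (conj_orbit H (eP P)) < (pi / 2 : R)%:E)%E) ->
   exists Q : 'M[R[i]]_n, orth_proj Q /\ \rank Q = m /\
      forall h, H h -> h *m Q = Q *m h)
  /\
  (exists H : set 'M[R[i]]_2, subgroupU H /\
   exists P : 'M[R[i]]_2, orth_proj P /\ \rank P = 1%N /\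
     radius_inf 1 (conj_orbit H (eP P)) = (pi / 2 : R)%:E /\
     ~ (exists Q : 'M[R[i]]_2, orth_proj Q /\ \rank Q = 1%N /\
          forall h, H h -> h *m Q = Q *m h)).
Proof.
split.
  move=> m n _ _ H HH [P [PP [_ rad]]]; exact: radius_lt_invariant_projection rad.
have noQ : ~ exists Q : 'M[R[i]]_2, orth_proj Q /\ \rank Q = 1%N /\
    forall h, pauliZ_normalizer h -> h *m Q = Q *m h.
  by move=> [Q [_ [rQ /pauliZ_normalizer_irreducible]]].
exists (@pauliZ_normalizer R); split; first exact: pauliZ_normalizer_subgroup.
exists (delta_mx 0 0); split; first exact: orth_proj_delta.
split; first by rewrite mxrank_delta.
split => //; apply/eqP; rewrite eq_le; apply/andP; split; last first.
  (* Lower bound: a smaller radius would produce the projection that [noQ] excludes. *)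
  rewrite leNgt; apply/negP => rad; apply: noQ.
  apply: radius_lt_invariant_projection rad; first exact: pauliZ_normalizer_subgroup.
  exact: orth_proj_delta.
(* Upper bound: [pauliX] serves as centre, since it anticommutes with both points of the orbit. *)
apply: ereal_inf_lbound; exists (pi / 2) => //.
exists (pauliX R); split; first exact: pauliX_Grass.
have [[[[hX hZ] XX] ZZ] XZ] := (pauliX_hermitian R, pauliZ_hermitian R, pauliX_sqr R,
  pauliZ_sqr R, pauliXZ R).
move=> a /pauliZ_normalizer_orbit[] ->; apply: dinf_anticommuting_le => //.
- by rewrite adjN hZ.
- by rewrite mulNmx mulmxN opprK.
- by rewrite mulNmx mulmxN XZ.
Qed.
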